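(* Let $b\ge2$, $A=\{0,\dots,b-1\}$, and let $P=\{p_1,p_2\}$ where $p_1,p_2$ are two prime numbers. For a sequence $x\in A^\omega$ the following are equivalent: (I) The Toeplitz transform $\tau_P(x)$ is normal to base $b$. (II) For every integer $k\ge0$ and every family $(u_{i_1,i_2})_{0\le i_1,i_2\le k}$ of finite words over $A$ of arbitrary lengths, $$\lim_{N\to\infty}\frac1N\#\Big\{n: 1\le n\le N,\ \text{and for all }0\le i_1,i_2\le k,\ u_{i_1,i_2}\text{ occurs in }x\text{ at position }(p_1-1)(p_2-1)p_1^{i_1}p_2^{i_2}n\Big\}= b^{-\sum_{0\le i_1,i_2\le k}|u_{i_1,i_2}|}.$$
   Context: Let $j_1<j_2<\cdots$ enumerate the positive integers divisible by neither $p_1$ nor $p_2$; every positive integer $n$ is uniquely $n=j_kp_1^{e_1}p_2^{e_2}$ with $e_1,e_2\ge0$. The Toeplitz transform is $\tau_P(a_1a_2\cdots)=t_1t_2\cdots$ with $t_n=a_k$ for such $n$. Words are finite sequences over $A$ and $|u|$ is the length of $u$. For $x=a_1a_2\cdots$, a word $u$ occurs in $x$ at position $m$ if $a_m a_{m+1}\cdots a_{m+|u|-1}=u$. A sequence in $A^\omega$ is normal to base $b$ if it is the base-$b$ expansion of a real number normal to base $b$ (i.e. simply normal to each base $b,b^2,b^3,\dots$, where simple normality to base $s$ means each digit of $\{0,\dots,s-1\}$ has asymptotic frequency $1/s$ in the base-$s$ expansion). *)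

(* Defs.v *)
From mathcomp Require Import all_boot all_order all_algebra.
From mathcomp Require Import all_classical all_reals all_analysis.

Set Implicit Arguments.
Unset Strict Implicit.
Unset Printing Implicit Defensive.

Import Order.TTheory GRing.Theory Num.Theory.
Import numFieldNormedType.Exports.

(* An infinite sequence a_1 a_2 ... is stored as x : nat -> T with
   x i = a_(i+1), so that letter x n is a_n for n >= 1 (letter x 0 is junk). *)
Definition letter (T : Type) (x : nat -> T) (n : nat) : T := x n.-1.

Definition occurs (T : eqType) (x : nat -> T) (u : seq T) (m : nat) : bool :=
  [seq letter x (m + l) | l <- iota 0 (size u)] == u.

Section Toeplitz.
Variables p1 p2 : nat.

Definition pfree (m : nat) : bool := ~~ (p1 %| m) && ~~ (p2 %| m).

(* If j_1 < j_2 < ... enumerates the positive pfree integers, the rank of j_k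
   is k. *)
Definition pfree_rank (m : nat) : nat := count pfree (iota 1 m).

(* The factor j_k of n = j_k p1^e1 p2^e2, n >= 1. *)
Definition pfree_part (n : nat) : nat :=
  n %/ (p1 ^ logn p1 n * p2 ^ logn p2 n).

Definition toeplitz (T : Type) (x : nat -> T) : nat -> T :=
  fun i => letter x (pfree_rank (pfree_part i.+1)).

Lemma pfree_gt0 m : pfree m -> 0 < m.
Proof. by case: m => //; rewrite /pfree !dvdn0. Qed.

Lemma pfree_partE m e1 e2 : prime p1 -> prime p2 -> p1 != p2 -> pfree m ->
  pfree_part (m * p1 ^ e1 * p2 ^ e2) = m.
Proof.
move=> P1 P2 ne12 /[dup] /pfree_gt0 m0 /andP[n1 n2].
have L (p q e : nat) : prime p -> prime q -> p != q -> logn p (q ^ e) = 0.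
  by move=> Pp Pq npq; rewrite lognX logn_prime // (negPf npq) muln0.
have Lm (p : nat) : prime p -> ~~ (p %| m) -> logn p m = 0.
  by move=> Pp ndv; apply/eqP; rewrite -leqn0 leqNgt logn_gt0 mem_primes Pp m0.
have g1 : 0 < p1 ^ e1 by rewrite expn_gt0 prime_gt0.
have g2 : 0 < p2 ^ e2 by rewrite expn_gt0 prime_gt0.
rewrite /pfree_part !lognM ?muln_gt0 ?m0 ?g1 //.
rewrite !Lm // pfactorK // pfactorK // (L p1 p2) // (L p2 p1) // 1?eq_sym //.
by rewrite !add0n addn0 -mulnA mulnK // muln_gt0 g1.
Qed.

(* The defining property of the Toeplitz transform, for the increasing
   enumeration j of the positive integers divisible by neither p1 nor p2. *)
Lemma toeplitzE (T : Type) (x : nat -> T) (j : nat -> nat) :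
  prime p1 -> prime p2 -> p1 != p2 ->
  (forall k l, 0 < k -> k < l -> j k < j l) ->
  (forall m, pfree m <-> exists2 k, 0 < k & j k = m) ->
  forall k e1 e2, 0 < k ->
    letter (toeplitz x) (j k * p1 ^ e1 * p2 ^ e2) = letter x k.
Proof.
move=> P1 P2 ne12 jinc jP k e1 e2 k0.
have fj l : 0 < l -> pfree (j l) by move=> l0; apply/jP; exists l.
have pos : 0 < j k * p1 ^ e1 * p2 ^ e2.
  by rewrite !muln_gt0 (pfree_gt0 (fj _ k0)) !expn_gt0 !prime_gt0.
rewrite {1}/letter /toeplitz prednK // pfree_partE ?fj //; congr letter.
rewrite /pfree_rank -size_filter.
suff /perm_size-> : perm_eq [seq m <- iota 1 (j k) | pfree m]
                            [seq j l | l <- iota 1 k].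
  by rewrite size_map size_iota.
have jle l l' : 0 < l -> l <= l' -> j l <= j l'.
  by move=> l0; rewrite leq_eqVlt => /orP[/eqP->//|/(jinc _ _ l0)/ltnW].
have jlt l l' : 0 < l' -> j l <= j l' -> l <= l'.
  move=> l'0; apply: contraTT; rewrite -!ltnNge; exact: jinc.
apply: uniq_perm; first by rewrite filter_uniq ?iota_uniq.
  rewrite map_inj_in_uniq ?iota_uniq // => l l'.
  rewrite !mem_iota => /andP[l0 _] /andP[l'0 _] e.
  by apply/eqP; rewrite eqn_leq; apply/andP; split; apply: jlt; rewrite // e.
move=> m; rewrite mem_filter mem_iota; apply/idP/mapP.
  case/andP => /jP[l l0 <-] /andP[_]; rewrite add1n ltnS => h.
  by exists l; rewrite // mem_iota l0 add1n ltnS; apply: jlt.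
case=> l; rewrite mem_iota add1n ltnS => /andP[l0 lk] ->.
by rewrite fj // (pfree_gt0 (fj _ l0)) add1n ltnS; apply: jle.
Qed.

End Toeplitz.

Local Open Scope ring_scope.
Local Open Scope classical_set_scope.

(* Asymptotic frequency of the positive integers n satisfying Q. *)
Definition has_frequency (R : realType) (Q : pred nat) (f : R) : Prop :=
  (count Q (iota 1 N))%:R / N%:R @[N --> \oo] --> f.

(* The n-th digit after the point of the base-s expansion of r, n >= 1. *)
Definition digit (R : realType) (s : nat) (r : R) (n : nat) : int :=
  (Num.floor (s%:R ^+ n * r) %% s%:Z)%Z.

Definition simply_normal (R : realType) (s : nat) (r : R) : Prop :=
  forall d : nat, (d < s)%N ->
    has_frequency [pred n | digit s r n == d%:Z] (s%:R^-1 : R).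

Definition normal_number (R : realType) (b : nat) (r : R) : Prop :=
  forall l : nat, (0 < l)%N -> simply_normal (b ^ l) r.

Definition is_expansion (R : realType) (b : nat) (x : nat -> 'I_b) (r : R) :
  Prop :=
  0 <= r < 1 /\
  forall n : nat, (0 < n)%N -> digit b r n = (nat_of_ord (letter x n))%:Z.

Definition normal_seq (R : realType) (b : nat) (x : nat -> 'I_b) : Prop :=
  exists r : R, is_expansion x r /\ normal_number b r.

(* Main.v *)
(* Write t for the transform of x, phi = (p1-1)(p2-1) and D = (p1 p2)^(k+1).
   Since j_(phi a + c) = p1 p2 a + j_c, the letter of x at position
   phi p1^i1 p2^i2 n + c reappears in t at position
   D n + j_c p1^(k-i1) p2^(k-i2).  Condition (II) thus says that, for every k,
   the letters of t at finitely many distinct offsets from D n are jointly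
   equidistributed in n, for all offsets divisible by neither p1^(k+1) nor
   p2^(k+1).
   (I) => (II): cut t into aligned blocks of length D L; almost all n have
   their whole pattern inside one block, and L is arbitrary.
   (II) => (I): let G n be the deviation of the number of occurrences of a
   word of length l among the aligned blocks of a window starting at D n,
   ignoring the few forbidden offsets.  Pair correlations vanish by (II), so
   the mean square of G over all n is at most about D.  The aligned windows are
   those with n divisible by l, and the sum of |G n| over them is at most the
   sum over all n, i.e. O(sqrt D) per n, which is negligible against the D
   blocks of a window as k grows. *)
Require Import Defs.
From mathcomp Require Import all_boot all_order all_algebra.
From mathcomp Require Import all_classical all_reals all_analysis.
From mathcomp Require Import zify ring lra.

Set Implicit Arguments.
Unset Strict Implicit.
Unset Printing Implicit Defensive.

Import Order.TTheory GRing.Theory Num.Theory.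
Import numFieldNormedType.Exports.

(** * Counting the integers divisible by neither prime *)

Section PfreeRank.
Variables p1 p2 : nat.
Hypotheses (P1 : prime p1) (P2 : prime p2) (ne12 : p1 != p2).

Local Notation pfree := (pfree p1 p2).
Local Notation rank := (pfree_rank p1 p2).

Lemma pfree_coprime m : pfree m = coprime (p1 * p2) m.
Proof. by rewrite coprimeMl !prime_coprime. Qed.

Lemma pfree_periodic a m : pfree (p1 * p2 * a + m) = pfree m.
Proof. by rewrite !pfree_coprime /coprime [_ * a]mulnC gcdnMDl. Qed.

Lemma pfree_rankD a m :
  rank (a + m) = rank a + count (fun i => pfree (a + i)) (iota 1 m).
Proof.
rewrite /pfree_rank iotaD count_cat [1 + a]addnC iotaDl count_map.
by congr (_ + _).
Qed.

Lemma pfree_rankS m : rank m.+1 = rank m + pfree m.+1.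
Proof. by rewrite -addn1 pfree_rankD /= addn0 addn1. Qed.

Lemma pfree_rank_lt m m' : pfree m' -> m < m' -> rank m < rank m'.
Proof.
case: m' => // m' fm'; rewrite ltnS => lm.
rewrite pfree_rankS fm' addn1 ltnS -(subnKC lm) pfree_rankD.
exact: leq_addr.
Qed.

Lemma pfree_rank_inj m m' : pfree m -> pfree m' -> rank m = rank m' -> m = m'.
Proof.
move=> fm fm' e; case: (ltngtP m m') => // h.
  by have := pfree_rank_lt fm' h; rewrite e ltnn.
by have := pfree_rank_lt fm h; rewrite e ltnn.
Qed.

(** This is Euler's totient of [p1 * p2]. The rank counts from 1 to [p1 * p2], the totient from 0 to
    [p1 * p2 - 1]; the two extreme terms agree, since both test whether [p1 * p2] is 1. *)
Lemma pfree_rank_period : rank (p1 * p2) = (p1 - 1) * (p2 - 1).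
Proof.
have Q1 : 1 < p1 * p2.
  by rewrite (leq_trans (prime_gt1 P1)) // leq_pmulr // prime_gt0.
rewrite !subn1 -(totient_prime P1) -(totient_prime P2) -totient_coprime; last first.
  by rewrite prime_coprime // dvdn_prime2.
have -> : rank (p1 * p2) = \sum_(1 <= d < (p1 * p2).+1) coprime (p1 * p2) d.
  rewrite /index_iota subn1 /= /pfree_rank -sum1_count big_mkcond /=.
  by apply: eq_bigr => d _; rewrite pfree_coprime.
rewrite totient_count_coprime big_nat_recr /=; last exact: ltnW.
rewrite [RHS]big_ltn; last exact: ltnW.
by rewrite /coprime gcdnn gcdn0 addnC.
Qed.

Lemma pfree_rank_periodic a m :
  rank (p1 * p2 * a + m) = (p1 - 1) * (p2 - 1) * a + rank m.
Proof.
rewrite pfree_rankD; congr (_ + _); last first.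
  by apply: eq_count => i; rewrite pfree_periodic.
elim: a => [|a IH]; first by rewrite !muln0.
rewrite mulnS addnC pfree_rankD IH mulnS addnC; congr (_ + _).
by rewrite -pfree_rank_period; apply: eq_count => i; rewrite pfree_periodic.
Qed.

(** The rank grows by at most 1 per step and is unbounded by periodicity, so it first reaches [k] by
    a jump of 1, which occurs at a [pfree] integer. *)
Lemma pfree_rank_surj k : 0 < k -> exists2 m, pfree m & rank m = k.
Proof.
move=> k0.
have ex : exists m, k <= rank m.
  exists (p1 * p2 * k + 0); rewrite pfree_rank_periodic addn0 leq_pmull //.
  by rewrite muln_gt0 !subn_gt0 !prime_gt1.
case: (ex_minnP ex) => -[|m] hm mn; first by move: hm; rewrite leqNgt k0.
have lm : rank m < k by rewrite ltnNge; apply/negP => /mn; rewrite ltnn.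
exists m.+1; move: hm; rewrite pfree_rankS; case: (pfree m.+1) => //=; lia.
Qed.

Lemma dvdn_pfactors s : p1 ^ logn p1 s * p2 ^ logn p2 s %| s.
Proof.
rewrite Gauss_dvd ?pfactor_dvdnn //.
by rewrite coprimeXl ?coprimeXr // prime_coprime // dvdn_prime2.
Qed.

Lemma pfree_part_gt0 s : 0 < s -> 0 < pfree_part p1 p2 s.
Proof.
move=> s0; rewrite /pfree_part divn_gt0; first exact: dvdn_leq s0 (dvdn_pfactors s).
by rewrite muln_gt0 !expn_gt0 !prime_gt0.
Qed.

Lemma pfree_pfree_part s : 0 < s -> pfree (pfree_part p1 p2 s).
Proof.
move=> s0; have m0 := pfree_part_gt0 s0.
have L (p q e : nat) : prime p -> prime q -> p != q -> logn p (q ^ e) = 0.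
  by move=> Pp Pq npq; rewrite lognX logn_prime // (negPf npq) muln0.
rewrite /Defs.pfree -[p1 %| _]/(p1 ^ 1 %| _) -[p2 %| _]/(p2 ^ 1 %| _).
rewrite !pfactor_dvdn // /pfree_part !logn_div ?dvdn_pfactors //.
have e0 p i : prime p -> 0 < p ^ i by move=> Pp; rewrite expn_gt0 prime_gt0.
rewrite !lognM ?e0 // !pfactorK // (L p1 p2) // (L p2 p1) 1?eq_sym //.
by rewrite addn0 add0n !subnn.
Qed.

Lemma pfree_partK s :
  pfree_part p1 p2 s * p1 ^ logn p1 s * p2 ^ logn p2 s = s.
Proof. by rewrite -mulnA divnK // dvdn_pfactors. Qed.

Lemma logn_pfree m e1 e2 : pfree m ->
  logn p1 (m * p1 ^ e1 * p2 ^ e2) = e1 /\ logn p2 (m * p1 ^ e1 * p2 ^ e2) = e2.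
Proof.
move=> fm; have m0 := pfree_gt0 fm.
have e0 p i : prime p -> 0 < p ^ i by move=> Pp; rewrite expn_gt0 prime_gt0.
case/andP: (fm) => n1 n2.
have L p : prime p -> ~~ (p %| m) -> logn p m = 0.
  by move=> Pp ndv; rewrite lognE Pp m0 (negPf ndv).
rewrite !lognM ?muln_gt0 ?m0 ?e0 // !L // !pfactorK // !lognX !logn_prime //.
by rewrite (negPf ne12) eq_sym (negPf ne12) !muln0 !addn0.
Qed.

(** The dictionary between [x] and its transform: with a = p1^i1 p2^i2 n, the index on the left
    factors as (p1 p2 a + m) p1^(K-i1) p2^(K-i2), and adding p1 p2 a to m raises the rank by
    (p1-1)(p2-1) a. *)
Lemma letter_toeplitz (T : Type) (x : nat -> T) K i1 i2 n m :
  i1 <= K -> i2 <= K -> pfree m ->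
  letter (toeplitz p1 p2 x)
    ((p1 * p2) ^ K.+1 * n + m * p1 ^ (K - i1) * p2 ^ (K - i2)) =
  letter x ((p1 - 1) * (p2 - 1) * p1 ^ i1 * p2 ^ i2 * n + pfree_rank p1 p2 m).
Proof.
move=> h1 h2 fm.
have E : (p1 * p2) ^ K.+1 * n + m * p1 ^ (K - i1) * p2 ^ (K - i2) =
   (p1 * p2 * (p1 ^ i1 * p2 ^ i2 * n) + m) * p1 ^ (K - i1) * p2 ^ (K - i2).
  have e i : i <= K -> forall p, p ^ K.+1 = p * p ^ i * p ^ (K - i).
    by move=> iK p; rewrite -mulnA -expnD subnKC // expnS.
  rewrite expnMn {1}(e i1 h1) {1}(e i2 h2); ring.
have fm' : pfree (p1 * p2 * (p1 ^ i1 * p2 ^ i2 * n) + m) by rewrite pfree_periodic.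
rewrite E {1}/letter /toeplitz prednK; last first.
  by rewrite 2!muln_gt0 (pfree_gt0 fm') !expn_gt0 !prime_gt0.
by rewrite pfree_partE // pfree_rank_periodic !mulnA.
Qed.

End PfreeRank.

Local Open Scope ring_scope.
Local Open Scope classical_set_scope.

(** * Sequences whose averages tend to zero *)

Section MeanZero.
Variable R : realType.
Implicit Types (u v : nat -> R) (e : R).

(** Convergence of the Cesaro means to 0, cleared of the division by [N]. *)
Definition mean_zero u :=
  forall e, 0 < e -> exists N0, forall N, (N0 <= N)%N ->
    `|\sum_(n < N) u n| <= e * N%:R.

Lemma eq_mean_zero u v : u =1 v -> mean_zero u -> mean_zero v.
Proof.
move=> uv mu e e0; have [N0 h] := mu e e0; exists N0 => N /h.
by under eq_bigr do rewrite uv.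
Qed.

Lemma mean_zero0 : mean_zero (fun=> 0).
Proof. by move=> e e0; exists 0%N => N _; rewrite big1 // normr0 mulr_ge0 // ltW. Qed.

Lemma mean_zeroD u v :
  mean_zero u -> mean_zero v -> mean_zero (fun n => u n + v n).
Proof.
move=> mu mv e e0; have e20 : 0 < e / 2 by lra.
have [N1 h1] := mu _ e20; have [N2 h2] := mv _ e20.
exists (N1 + N2)%N => N hN; rewrite big_split /=.
apply: (le_trans (ler_normD _ _)).
have := h1 N (leq_trans (leq_addr _ _) hN).
have := h2 N (leq_trans (leq_addl _ _) hN); lra.
Qed.

Lemma mean_zeroZ a u : mean_zero u -> mean_zero (fun n => a * u n).
Proof.
move=> mu e e0; have a0 : 0 < `|a| + 1 by rewrite ltr_wpDl.
have [|N0 h] := mu (e / (`|a| + 1)); first exact: divr_gt0.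
exists N0 => N /h hN; rewrite -mulr_sumr normrM.
apply: (le_trans (ler_wpM2l (normr_ge0 a) hN)).
rewrite mulrA ler_wpM2r // mulrCA -[leRHS]mulr1 ler_wpM2l ?(ltW e0) //.
by rewrite ler_pdivrMr // mul1r lerDl.
Qed.

Lemma mean_zero_sum (I : Type) (r : seq I) (P : pred I) (u : I -> nat -> R) :
  (forall i, P i -> mean_zero (u i)) ->
  mean_zero (fun n => \sum_(i <- r | P i) u i n).
Proof.
move=> mu; elim: r => [|i r IH].
  by apply: eq_mean_zero mean_zero0 => n; rewrite big_nil.
case Pi: (P i).
  by apply: eq_mean_zero (mean_zeroD (mu i Pi) IH) => n; rewrite big_cons Pi.
by apply: eq_mean_zero IH => n; rewrite big_cons Pi.
Qed.

Lemma sum_blocks (L M : nat) (u : nat -> R) :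
  \sum_(n < L * M) u n = \sum_(q < M) \sum_(i < L) u (L * q + i)%N.
Proof.
elim: M => [|M IH]; first by rewrite muln0 !big_ord0.
by rewrite mulnS addnC big_split_ord /= IH big_ord_recr.
Qed.

Lemma archimedean_mul (a e : R) : 0 <= a -> 0 < e -> exists C : nat, a <= e * C%:R.
Proof.
move=> a0 e0; exists (Num.bound (a / e)).
by rewrite -ler_pdivrMl // mulrC ltW // archi_boundP // divr_ge0 // ltW.
Qed.

(** Only complete blocks need control: the incomplete last one contributes at most [L], which is
    below [e / 2 * N] for large [N]. *)
Lemma mean_zero_blocks u : (forall n, `|u n| <= 1) ->
  (forall e, 0 < e -> exists2 L, (0 < L)%N &
     exists M0, forall M, (M0 <= M)%N ->
       `|\sum_(n < L * M) u n| <= e * (L * M)%:R) ->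
  mean_zero u.
Proof.
move=> u1 H e e0; have e20 : 0 < e / 2 by lra.
have [L L0 [M0 h]] := H _ e20.
have [C hC] := archimedean_mul (ler0n R L) e20.
exists (L * M0 + C)%N => N hN.
rewrite (divn_eq N L) mulnC big_split_ord /=.
apply: (le_trans (ler_normD _ _)).
have hM : (M0 <= N %/ L)%N by rewrite leq_divRL // mulnC (leq_trans _ hN) // leq_addr.
have := h _ hM.
have : `|\sum_(i < N %% L) u (L * (N %/ L) + i)%N| <= L%:R.
  apply: (le_trans (ler_norm_sum _ _ _)).
  apply: (@le_trans _ _ (\sum_(i < N %% L) 1)); first exact: ler_sum.
  by rewrite sumr_const card_ord ler_nat ltnW // ltn_pmod.
have : e / 2 * C%:R <= e / 2 * N%:R.
  by rewrite ler_pM2l // ler_nat (leq_trans _ hN) // leq_addl.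
have : (L * (N %/ L))%:R <= N%:R :> R by rewrite ler_nat mulnC leq_trunc_div.
have -> : (L * (N %/ L) + N %% L = N)%N by rewrite mulnC -divn_eq.
nra.
Qed.

Lemma mean_zero_shift k u : (forall n, `|u n| <= 1) ->
  mean_zero (fun n => u (k + n)%N) <-> mean_zero u.
Proof.
move=> u1.
have bnd : `|\sum_(n < k) u n| <= k%:R.
  apply: (le_trans (ler_norm_sum _ _ _)).
  apply: (@le_trans _ _ (\sum_(i < k) 1)); first exact: ler_sum.
  by rewrite sumr_const card_ord.
have kC e := archimedean_mul (ler0n R k) (e := e).
split=> mu e e0; have e20 : 0 < e / 2 by lra.
  have [N0 h] := mu _ e20; have [C hC] := kC _ e20.
  exists (k + N0 + C)%N => N hN.
  have kN : (k <= N)%N by lia.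
  have hN2 : (N0 <= N - k)%N by lia.
  rewrite -(subnKC kN) big_split_ord /=.
  apply: (le_trans (ler_normD _ _)).
  have := h _ hN2; have := bnd.
  have : e / 2 * C%:R <= e / 2 * N%:R by rewrite ler_pM2l // ler_nat; lia.
  have : e / 2 * (N - k)%:R <= e / 2 * N%:R by rewrite ler_pM2l // ler_nat; lia.
  rewrite subnKC //; lra.
have e30 : 0 < e / 3 by lra.
have [N0 h] := mu _ e30; have [C hC] := kC _ e30.
exists (k + N0 + C)%N => N hN.
have hN2 : (N0 <= k + N)%N by lia.
have := h _ hN2; rewrite big_split_ord /=.
move: bnd; set A := \sum_(n < k) _; set B := \sum_(n < N) _ => hA hAB.
have {1}-> : B = (A + B) - A by ring.
apply: (le_trans (ler_normB _ _)).
rewrite natrD in hAB.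
have : e / 3 * C%:R <= e / 3 * N%:R by rewrite ler_pM2l // ler_nat; lia.
have : e / 3 * k%:R <= e / 3 * N%:R by rewrite ler_pM2l // ler_nat; lia.
lra.
Qed.

Lemma has_frequencyP (Q : pred nat) (f : R) :
  has_frequency Q f <-> mean_zero (fun n => (Q n.+1)%:R - f).
Proof.
have E N : \sum_(n < N) ((Q n.+1)%:R - f) = (count Q (iota 1 N))%:R - N%:R * f.
  rewrite sumrB sumr_const card_ord -(mulr_natl f); congr (_ - _).
  elim: N => [|N IH]; first by rewrite big_ord0.
  have -> : iota 1 N.+1 = iota 1 N ++ [:: N.+1] by rewrite -(addn1 N) iotaD add1n addn1.
  by rewrite big_ord_recr count_cat natrD IH /= addn0.
have F e N : (0 < N)%N -> (`|f - (count Q (iota 1 N))%:R / N%:R| <= e) =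
    (`|\sum_(n < N) ((Q n.+1)%:R - f)| <= e * N%:R).
  move=> N0; have N0' : 0 < N%:R :> R by rewrite ltr0n.
  rewrite E -ler_pdivrMr // -[X in _ = (_ / X <= _)]gtr0_norm // -normf_div distrC.
  by rewrite mulrBl [N%:R * f]mulrC mulfK ?gt_eqF.
split=> [/cvgrPdist_le H e e0|H].
  have [N0 _ h] := H e e0; exists N0.+1 => N hN.
  by rewrite -F; [exact: h (ltnW hN) | lia].
apply/cvgrPdist_le => e e0; have [N0 h] := H e e0; exists N0.+1 => // N /= hN.
by rewrite F; [exact: h (ltnW hN) | lia].
Qed.

End MeanZero.

(** * Joint equidistribution of finitely many letters *)

Section Uniform.
Variables (R : realType) (b : nat).
Hypothesis b2 : (2 <= b)%N.

(* The letters Y o, o in O, behave along n as independent uniform ones. *)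
Definition uniform_on (I : eqType) (Y : I -> nat -> 'I_b) (O : seq I) :=
  forall f : I -> 'I_b,
    mean_zero (fun n => (all (fun o => Y o n == f o) O)%:R - b%:R ^- size O : R).

(** Passage to a marginal law: summing over the [b] values prescribed at [o] removes the constraint
    there. *)
Lemma uniform_on_behead (I : eqType) (Y : I -> nat -> 'I_b) o O :
  o \notin O -> uniform_on Y (o :: O) -> uniform_on Y O.
Proof.
move=> oO H f.
pose fa a o' := if o' == o then a else f o'.
have b0 : b%:R != 0 :> R by rewrite pnatr_eq0; lia.
apply: eq_mean_zero (mean_zero_sum (index_enum 'I_b) (P := xpredT)
  (fun a _ => H (fa a))) => n /=.
rewrite sumrB sumr_const card_ord -[X in _ - X = _]mulr_natl; congr (_ - _); last first.
  by rewrite exprS invfM mulrA divff // mul1r.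
rewrite (bigD1 (Y o n)) //= big1 ?addr0 => [|a ne].
  rewrite /fa !eqxx /=; congr (nat_of_bool _)%:R; apply: eq_in_all => o' o'O.
  by rewrite ifN //; apply: contraNneq oO => <-.
by rewrite /fa eqxx eq_sym (negPf ne).
Qed.

Lemma uniform_on_sub (I : eqType) (Y : I -> nat -> 'I_b) O O' :
  uniq O -> uniq O' -> {subset O' <= O} -> uniform_on Y O -> uniform_on Y O'.
Proof.
move=> uO uO' sub H.
pose D := [seq o <- O | o \notin O'].
have uD : uniq D by rewrite filter_uniq.
have pO : perm_eq (D ++ O') O.
  apply: uniq_perm => //.
    rewrite cat_uniq uD uO' andbT; apply/hasPn => o oO'.
    by rewrite mem_filter oO'.
  move=> o; rewrite mem_cat mem_filter; case: (boolP (o \in O')) => /= [/sub->//|_].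
  by rewrite orbF.
have {}H : uniform_on Y (D ++ O').
  move=> f; apply: eq_mean_zero (H f) => n.
  by rewrite (perm_all _ pO) (perm_size pO).
have : uniq (D ++ O') by rewrite (perm_uniq pO).
elim: D H {uD pO} => [//|o D IH] H /= /andP[oD uD].
by apply: IH => //; apply: uniform_on_behead H.
Qed.

Lemma uniform_on_embed (I J : eqType) (Y : I -> nat -> 'I_b) (Z : J -> nat -> 'I_b)
    (h : J -> I) O O' :
  uniq O -> uniq O' -> {in O' &, injective h} -> {in O', forall o, h o \in O} ->
  {in O', forall o n, Z o n = Y (h o) n} ->
  uniform_on Y O -> uniform_on Z O'.
Proof.
move=> uO uO' hinj hO YZ H f.
have uhO : uniq (map h O') by rewrite map_inj_in_uniq.
have sub : {subset map h O' <= O} by move=> _ /mapP[j jO' ->]; exact: hO.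
have {}H := uniform_on_sub uO uhO sub H.
(* The empty list is treated apart because [nth] below needs a default element [o0]. *)
case: O' uO' hinj hO YZ uhO sub H => [|o0 O''] uO' hinj hO YZ uhO sub H.
  by apply: (eq_mean_zero _ (@mean_zero0 R)) => n; rewrite /= expr0 invr1 subrr.
(* On the image of [h], this is [f] composed with the inverse of [h]. *)
pose g i := f (nth o0 (o0 :: O'') (index i (map h (o0 :: O'')))).
apply: eq_mean_zero (H g) => n; rewrite size_map all_map.
congr ((nat_of_bool _)%:R - _); apply: eq_in_all => o oO /=.
rewrite YZ // /g; suff -> : index (h o) (map h (o0 :: O'')) = index o (o0 :: O'').
  by rewrite nth_index.
rewrite -{1}(nth_index o0 oO) -(nth_map o0 (h o0)) ?index_mem //.
by rewrite index_uniq // size_map index_mem.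
Qed.

Lemma indicator_sub_le1 (c : bool) n : `|c%:R - b%:R ^- n : R| <= 1.
Proof.
have b1 : 1 <= b%:R :> R by rewrite ler1n; lia.
have h1 : b%:R ^- n <= 1 :> R.
  by rewrite invf_le1 ?exprn_gt0 ?exprn_ege1 // (lt_le_trans _ b1).
have h0 : 0 <= b%:R ^- n :> R by rewrite invr_ge0 exprn_ge0 // (le_trans _ b1).
rewrite ler_norml; case: c => /=; lra.
Qed.

(** Let C exceed every offset and group the n into blocks of C + L. For the first L members of a
    block, the pattern at D n fits inside one aligned block of length D (C + L), where the
    hypothesis applies; the other C members are a negligible fraction when L is large. *)
Lemma uniform_on_progression (Y : nat -> 'I_b) D O :
  (0 < D)%N -> uniq O ->
  (forall l, (0 < l)%N -> uniform_on (fun o n => Y (l * n + o)%N) (iota 0 l)) ->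
  uniform_on (fun o n => Y (D * n + o)%N) O.
Proof.
move=> D0 uO H f.
set e := fun n => _.
have e1 n : `|e n| <= 1 by exact: indicator_sub_le1.
pose C := (\max_(o <- O) o.+1)%N.
have OC o : o \in O -> (o < C)%N by move=> oO; rewrite /C (big_rem o) //= leq_max leqnn.
apply: mean_zero_blocks => // eps eps0.
have eps20 : 0 < eps / 2 by lra.
have [L' hL'] := archimedean_mul (ler0n R C) eps20.
(* [L'] makes [C] at most [eps / 2] times [L]; the added 1 keeps the block nonempty. *)
pose L := (L' + 1)%N; exists (C + L)%N; first by rewrite /L; lia.
have mz : mean_zero (fun q => \sum_(i < L) e ((C + L) * q + i)%N).
  apply: mean_zero_sum => i _.
  have l0 : (0 < D * (C + L))%N by rewrite muln_gt0 D0 /L; lia.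
  have := @uniform_on_embed _ _ _ (fun o n => Y (D * ((C + L) * n + i) + o)%N)
     (fun o => D * i + o)%N _ O (iota_uniq _ _) uO _ _ _ (H _ l0).
  apply.
  - by move=> o o' _ _ /addnI.
  - move=> o /OC oC; rewrite mem_iota /=; have := ltn_ord i; rewrite add0n; nia.
  - by move=> o _ n; congr Y; ring.
have [M0 h] := mz _ eps20; exists M0 => M hM.
rewrite sum_blocks.
under eq_bigr => q _ do rewrite (addnC C L) big_split_ord /= (addnC L C).
rewrite big_split /=; apply: (le_trans (ler_normD _ _)).
have := h _ hM; set A := `|_|; set B := `|_| => hA.
have hB : B <= C%:R * M%:R.
  apply: (le_trans (ler_norm_sum _ _ _)).
  apply: (@le_trans _ _ (\sum_(q < M) C%:R)); last first.
    by rewrite sumr_const card_ord mulr_natr.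
  apply: ler_sum => q _; apply: (le_trans (ler_norm_sum _ _ _)).
  apply: (@le_trans _ _ (\sum_(i < C) 1)); first exact: ler_sum.
  by rewrite sumr_const card_ord.
have M00 : 0 <= M%:R :> R by [].
have : 1 <= (C + L)%:R :> R by rewrite ler1n /L; lia.
have : L'%:R <= (C + L)%:R :> R by rewrite ler_nat /L; lia.
rewrite natrM; set CL := (C + L)%:R => h1 h2.
have : C%:R * M%:R <= eps / 2 * CL * M%:R.
  by rewrite ler_wpM2r // (le_trans hL') // ler_wpM2l // ltW.
have : eps / 2 * M%:R <= eps / 2 * CL * M%:R.
  by rewrite ler_wpM2r // -[leLHS]mulr1 ler_wpM2l // ltW.
lra.
Qed.

End Uniform.

(** * Second moments and equidistribution of aligned blocks *)

Section SecondMoment.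
Variable R : realType.

(** Expand the square: the diagonal contributes at most [#|I|] for each [n], and the cross terms,
    having mean zero, are eventually absorbed by the extra 1. *)
Lemma sum_sqr_bound (I : finType) (P : pred I) (v : I -> nat -> R) :
  (forall i n, `|v i n| <= 1) ->
  (forall i j, P i -> P j -> i != j -> mean_zero (fun n => v i n * v j n)) ->
  exists N0, forall N, (N0 <= N)%N ->
    \sum_(n < N) (\sum_(i | P i) v i n) ^+ 2 <= #|I|.+1%:R * N%:R.
Proof.
move=> v1 mv.
have mz : mean_zero (fun n => \sum_(i | P i) \sum_(j | P j && (j != i)) v i n * v j n).
  apply: mean_zero_sum => i Pi; apply: mean_zero_sum => j /andP[Pj ji].
  by apply: mv; rewrite // eq_sym.
have [N0 h] := mz 1 ltr01; exists N0 => N hN.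
have := ler_normlW (h N hN); rewrite mul1r.
have E n : (\sum_(i | P i) v i n) ^+ 2 =
    \sum_(i | P i) v i n ^+ 2 +
    \sum_(i | P i) \sum_(j | P j && (j != i)) v i n * v j n.
  rewrite expr2 mulr_suml -big_split /=; apply: eq_bigr => i Pi.
  by rewrite mulr_sumr (bigD1 i).
under [X in _ -> X <= _]eq_bigr do rewrite E.
rewrite big_split /= -natr1 mulrDl mul1r.
suff : \sum_(n < N) \sum_(i | P i) v i n ^+ 2 <= #|I|%:R * N%:R by lra.
apply: (@le_trans _ _ (\sum_(n < N) #|I|%:R)); last first.
  by rewrite sumr_const card_ord mulr_natr.
apply: ler_sum => n _; apply: (@le_trans _ _ (\sum_(i : I) 1)).
  rewrite big_mkcond; apply: ler_sum => i _; case: (P i) => //.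
  by rewrite -real_normK ?num_real // expr_le1.
by rewrite sumr_const.
Qed.

Lemma divn_block l i s : (0 < l)%N -> (l * i <= s < l * i + l)%N -> (s %/ l)%N = i.
Proof.
move=> l0 /andP[h1 h2]; rewrite -(subnKC h1) mulnC divnMDl // divn_small ?addn0 //.
by rewrite ltn_subLR // mulnC.
Qed.

Lemma sum_multiples (a m : nat) : (0 < a)%N ->
  \sum_(s < a * m) (a %| s.+1)%:R = m%:R :> R.
Proof.
move=> a0; rewrite (sum_blocks _ _ (fun s => (a %| s.+1)%:R)).
rewrite (eq_bigr (fun=> 1)) ?sumr_const ?card_ord // => q _.
have a1 : (a.-1 < a)%N by lia.
rewrite (bigD1 (Ordinal a1)) //= big1 ?addr0 => [|i].
  by rewrite -addnS prednK // dvdn_addr ?dvdn_mulr ?dvdnn.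
rewrite -val_eqE /= => ne; rewrite -addnS dvdn_addr ?dvdn_mulr //.
case: (boolP (a %| i.+1)%N) => // /dvdn_leq; have := ltn_ord i; lia.
Qed.

(** Serves to compare aligned windows with all windows: counted from 0, [l * q + l.-1] is the index
    of the multiple [l * q.+1], and the terms in between are nonnegative. *)
Lemma sum_last_of_block (l M : nat) (u : nat -> R) : (0 < l)%N ->
  (forall n, 0 <= u n) ->
  \sum_(q < M) u (l * q + l.-1)%N <= \sum_(n < l * M) u n.
Proof.
move=> l0 u0; rewrite sum_blocks; apply: ler_sum => q _.
have l1 : (l.-1 < l)%N by lia.
by rewrite (bigD1 (Ordinal l1)) //= lerDl sumr_ge0.
Qed.

Variable b : nat.
Hypothesis b2 : (2 <= b)%N.

(** Offsets count from 0, hence [o.+1] in the divisibility conditions. A window in the proof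
    consists of D words of length l, so its length is D l. *)
Lemma uniform_on_aligned (Y : nat -> 'I_b) (p1 p2 : nat) :
  (1 < p1)%N -> (1 < p2)%N ->
  (forall K O, uniq O ->
    {in O, forall o, ~~ (p1 ^ K.+1 %| o.+1)%N && ~~ (p2 ^ K.+1 %| o.+1)%N} ->
    uniform_on R (fun o n => Y ((p1 * p2) ^ K.+1 * n.+1 + o)%N) O) ->
  forall l, (0 < l)%N -> uniform_on R (fun o n => Y (l * n + o)%N) (iota 0 l).
Proof.
move=> p11 p21 H l l0 f; rewrite size_iota.
set e := fun n => _.
have e1 n : `|e n| <= 1 by exact: indicator_sub_le1.
apply: mean_zero_blocks => // eps eps0.
(* One third for each error: the first window, the words meeting a forbidden offset, and the mean of
   |G|. *)
pose d := eps / 3; have d0 : 0 < d by rewrite /d; lra.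
(* The first term keeps the words meeting a forbidden offset to at most d D per window; the second
   gives D >= 2 l^2 / d^2, which the mean square estimate needs. *)
pose bd := 2 * l%:R / d + 2 * l%:R ^+ 2 / d ^+ 2.
have bd0 : 0 <= bd by rewrite addr_ge0 // divr_ge0 ?mulr_ge0 ?exprn_ge0 // ltW.
have [K hK] : exists K : nat, bd <= K.+1%:R.
  exists (Num.bound bd); apply: (le_trans (ltW (archi_boundP bd0))).
  by rewrite ler_nat.
pose a1 := (p1 ^ K.+1)%N; pose a2 := (p2 ^ K.+1)%N; pose D := (a1 * a2)%N.
have DE : ((p1 * p2) ^ K.+1)%N = D by rewrite expnMn.
have a1K : (K.+1 <= a1)%N by apply: ltnW; exact: ltn_expl.
have a2K : (K.+1 <= a2)%N by apply: ltnW; exact: ltn_expl.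
have D0 : (0 < D)%N by rewrite muln_gt0 (leq_trans _ a1K) ?(leq_trans _ a2K).
have DR : (D%:R : R) = a1%:R * a2%:R by rewrite natrM.
have a1R : bd <= a1%:R by rewrite (le_trans hK) // ler_nat.
have a2R : bd <= a2%:R by rewrite (le_trans hK) // ler_nat.
have bd1 : 2 * l%:R / d <= bd.
  by rewrite lerDl divr_ge0 ?mulr_ge0 ?exprn_ge0 // ltW.
have bd2 : 2 * l%:R ^+ 2 / d ^+ 2 <= bd.
  by rewrite lerDr divr_ge0 ?mulr_ge0 ?exprn_ge0 // ltW.
have D1R : 1 <= D%:R :> R by rewrite ler1n.
pose v (i : 'I_D) n : R :=
  (all (fun o => Y (D * n.+1 + (l * i + o))%N == f o) (iota 0 l))%:R - b%:R ^- l.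
have v1 i n : `|v i n| <= 1 by exact: indicator_sub_le1.
pose bad (s : nat) := (a1 %| s.+1)%N || (a2 %| s.+1)%N.
pose good (i : 'I_D) := ~~ has (fun o => bad (l * i + o)%N) (iota 0 l).
have mv i j : good i -> good j -> i != j -> mean_zero (fun n => v i n * v j n).
  move=> gi gj ij.
  pose O (i : 'I_D) := iota (l * i) l.
  have OE k : O k = map (addn (l * k)) (iota 0 l) by rewrite -iotaDl addn0.
  (* Extending [f] with period [l] lets one pattern prescribe the words at [i] and at [j]
     together. *)
  pose f' s := f (s %% l)%N.
  pose A (i : 'I_D) n := all (fun o => Y (D * n.+1 + (l * i + o))%N == f o) (iota 0 l).
  have AE k n : all (fun o => Y (D * n.+1 + o)%N == f' o) (O k) = A k n.
    rewrite OE all_map; apply: eq_in_all => o; rewrite mem_iota /= => ol.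
    by rewrite /f' [X in (X %% l)%N](_ : _ = (k * l + o)%N) ?modnMDl ?modn_small // mulnC.
  have gO k : good k -> {in O k, forall o, ~~ (a1 %| o.+1)%N && ~~ (a2 %| o.+1)%N}.
    by move=> /hasPn gk o; rewrite OE => /mapP[j' /gk + ->]; rewrite negb_or.
  have uO k : uniq (O k) by exact: iota_uniq.
  have mA k : good k -> mean_zero (fun n => (A k n)%:R - b%:R ^- l : R).
    move=> gk; have := H K _ (uO k) (gO k gk) f'; apply: eq_mean_zero => n.
    by rewrite DE AE size_iota.
  have mAA : mean_zero (fun n => (A i n && A j n)%:R - b%:R ^- (l + l) : R).
    have uOO : uniq (O i ++ O j).
      rewrite cat_uniq !uO andbT; apply/hasPn => s; rewrite !mem_iota.
      move=> hj; apply/negP => hi; move/negP: ij; apply.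
      by rewrite -val_eqE /= -(divn_block l0 hi) -(divn_block l0 hj).
    have gOO : {in O i ++ O j, forall o, ~~ (a1 %| o.+1)%N && ~~ (a2 %| o.+1)%N}.
      by move=> o; rewrite mem_cat => /orP[]; apply: gO.
    have := H K _ uOO gOO f'; apply: eq_mean_zero => n.
    by rewrite DE all_cat !AE size_cat !size_iota.
  (* With B = b^-l, (Ai - B)(Aj - B) = (Ai Aj - B^2) - B (Ai - B) - B (Aj - B), and each bracket on
     the right has mean zero. *)
  have := mean_zeroD mAA (mean_zeroD (mean_zeroZ (- b%:R ^- l) (mA i gi))
     (mean_zeroZ (- b%:R ^- l) (mA j gj))).
  apply: eq_mean_zero => n; rewrite /v -/(A i n) -/(A j n).
  by rewrite exprD invfM -mulnb natrM; ring.
have [N0 h] := sum_sqr_bound v1 mv; rewrite card_ord in h.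
pose G n := \sum_(i | good i) v i n.
(* c optimizes, up to constants, |G| <= G^2 / (2 c) + c / 2 below. *)
pose c := d * D%:R / l%:R.
have lR : 1 <= l%:R :> R by rewrite ler1n.
have lR0 : 0 < l%:R :> R by rewrite ltr0n.
have c0 : 0 < c by rewrite divr_gt0 // mulr_gt0 // ltr0n.
have DD : 2 * l%:R ^+ 2 / d ^+ 2 <= D%:R.
  rewrite (le_trans bd2) // (le_trans a1R) // DR -[leLHS]mulr1 ler_wpM2l //.
  by rewrite ler1n (leq_trans _ a2K).
have hG N : (N0 <= N)%N -> \sum_(n < N) `|G n| <= d * D%:R / l%:R * N%:R.
  move=> hN; have hGN := h N hN.
  have pt n : `|G n| <= (2 * c)^-1 * G n ^+ 2 + c / 2.
    have -> : (2 * c)^-1 * G n ^+ 2 + c / 2 =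
       `|G n| + (2 * c)^-1 * (`|G n| - c) ^+ 2.
      by rewrite sqrrB real_normK ?num_real //; field; rewrite gt_eqF.
    by rewrite lerDl mulr_ge0 ?sqr_ge0 // invr_ge0 mulr_ge0 // ltW.
  apply: (@le_trans _ _ (\sum_(n < N) ((2 * c)^-1 * G n ^+ 2 + c / 2))).
    by apply: ler_sum => n _.
  rewrite big_split /= -mulr_sumr sumr_const card_ord -[(c / 2) *+ N]mulr_natr.
  have hc : (2 * c)^-1 * D.+1%:R <= c / 2.
    have c20 : 0 < 2 * c by rewrite mulr_gt0.
    rewrite mulrC ler_pdivrMr //.
    have -> : c / 2 * (2 * c) = c ^+ 2 by field.
    have -> : c ^+ 2 = d ^+ 2 / l%:R ^+ 2 * D%:R * D%:R.
      by rewrite /c; field; rewrite gt_eqF.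
    apply: (@le_trans _ _ (2 * D%:R)); first by rewrite -natr1; lra.
    rewrite ler_wpM2r //.
    rewrite ler_pdivrMr ?exprn_gt0 // in DD.
    rewrite mulrAC ler_pdivlMr ?exprn_gt0 //; lra.
  apply: (@le_trans _ _ (c / 2 * N%:R + c / 2 * N%:R)); last by rewrite /c; lra.
  rewrite lerD2r; apply: (@le_trans _ _ ((2 * c)^-1 * (D.+1%:R * N%:R))).
    by rewrite ler_wpM2l // invr_ge0 mulr_ge0 // ltW.
  by rewrite mulrA ler_wpM2r.
have hbad : \sum_(i < D | ~~ good i) 1 <= d * D%:R :> R.
  (* Union bound: a bad word contains a multiple of a1 or of a2, and a window of length l D contains
     l a2 and l a1 of these. *)
  apply: (@le_trans _ _ (\sum_(i < D) \sum_(o < l)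
      ((a1 %| (l * i + o).+1)%:R + (a2 %| (l * i + o).+1)%:R))).
    rewrite big_mkcond; apply: ler_sum => i _; case: ifPn => [|_]; last first.
      by apply: sumr_ge0 => o _; rewrite addr_ge0.
    rewrite negbK => /hasP[ o]; rewrite mem_iota /= add0n => ol bo.
    rewrite (bigD1 (Ordinal ol)) //= -[1]addr0 lerD //; last first.
      by apply: sumr_ge0 => o' _; rewrite addr_ge0.
    by case/orP: bo => ->; case: (_ %| _)%N => /=; rewrite ?addr0 ?add0r ?lerDl.
  rewrite -(sum_blocks l D (fun s => (a1 %| s.+1)%:R + (a2 %| s.+1)%:R)).
  rewrite big_split /=.
  have -> : (l * D = a1 * (l * a2))%N by rewrite /D; ring.
  rewrite sum_multiples; last by rewrite (leq_trans _ a1K).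
  have -> : (a1 * (l * a2) = a2 * (l * a1))%N by ring.
  rewrite sum_multiples; last by rewrite (leq_trans _ a2K).
  have k1 := le_trans bd1 a1R; have k2 := le_trans bd1 a2R.
  rewrite ler_pdivrMr // in k1; rewrite ler_pdivrMr // in k2.
  have : (2 * l%:R) * a2%:R <= a1%:R * d * a2%:R by rewrite ler_wpM2r.
  have : (2 * l%:R) * a1%:R <= a2%:R * d * a1%:R by rewrite ler_wpM2r.
  rewrite DR !natrM; lra.
(* [C] makes [d * M.+1] at least 1, so that the first window is absorbed. *)
have [C hC] := archimedean_mul ler01 d0.
exists D => //; exists (N0 + C).+1 => -[//|M]; rewrite ltnS => hM.
(* The hypothesis speaks of [n.+1], hence not of the window at 0, whose D terms are bounded
   trivially. *)
rewrite sum_blocks big_ord_recl /=.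
have first_block : `|\sum_(i < D) e (D * 0 + i)%N| <= D%:R.
  apply: (le_trans (ler_norm_sum _ _ _)).
  apply: (@le_trans _ _ (\sum_(i < D) 1)); first exact: ler_sum.
  by rewrite sumr_const card_ord.
apply: (le_trans (ler_normD _ _)).
(* Aligned word D (q+1) + i starts at l D (q+1) + l i, so it is word i of the window at D (n+1) with
   n + 1 = l (q+1). *)
have vE (i : 'I_D) q : e (D * q.+1 + i)%N = v i (l * q + l.-1)%N.
  rewrite /e /v; congr ((nat_of_bool _)%:R - _); apply: eq_all => o.
  have -> : ((l * q + l.-1).+1 = l * q.+1)%N.
    by rewrite -addnS prednK // mulnS addnC.
  by congr (Y _ == _); ring.
have rest : `|\sum_(q < M) \sum_(i < D) e (D * q.+1 + i)%N| <=
    \sum_(q < M) `|G (l * q + l.-1)%N| + d * D%:R * M%:R.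
  apply: (le_trans (ler_norm_sum _ _ _)).
  have -> : d * D%:R * M%:R = \sum_(q < M) d * D%:R.
    by rewrite sumr_const card_ord mulr_natr.
  rewrite -big_split /=; apply: ler_sum => q _.
  rewrite (bigID good) /=; apply: (le_trans (ler_normD _ _)); apply: lerD.
    by under eq_bigr do rewrite vE.
  apply: le_trans hbad; apply: (le_trans (ler_norm_sum _ _ _)).
  exact: ler_sum.
have GM := sum_last_of_block M l0 (fun n => normr_ge0 (G n)).
have lM : (N0 <= l * M)%N.
  by rewrite (leq_trans _ (leq_pmull _ l0)) // (leq_trans _ hM) // leq_addr.
have := hG _ lM.
have -> : d * D%:R / l%:R * (l * M)%:R = d * D%:R * M%:R.
  by rewrite natrM; field; rewrite gt_eqF.
move=> hGM.
have hD : D%:R <= d * D%:R * M.+1%:R.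
  have : 1 <= d * M.+1%:R.
    apply: (le_trans hC); rewrite ler_wpM2l ?(ltW d0) //.
    by rewrite ler_nat ltnW // ltnS (leq_trans _ hM) // leq_addl.
  by move/(ler_wpM2r (ler0n R D)); rewrite mul1r mulrAC.
have MM : d * D%:R * M%:R <= d * D%:R * M.+1%:R.
  by apply: ler_wpM2l; [rewrite mulr_ge0 // ltW | rewrite ler_nat].
have -> : eps * (D * M.+1)%:R = 3 * (d * D%:R * M.+1%:R) by rewrite /d natrM; field.
lra.
Qed.

End SecondMoment.

(** * Expansions in base [b] and in its powers *)

Section Digits.
Variable b : nat.
Hypothesis b2 : (2 <= b)%N.

(** Horner's scheme with the leading digit first, as an expansion is read; [word_value f 0 l]
    encodes a bare word. *)
Fixpoint word_value (Y : nat -> 'I_b) (m l : nat) : nat :=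
  if l is l'.+1 then (word_value Y m l' * b + Y (m + l'))%N else 0%N.

Lemma word_value_lt Y m l : (word_value Y m l < b ^ l)%N.
Proof.
elim: l => //= l IH; rewrite expnSr.
have := leq_mul2r b (word_value Y m l).+1 (b ^ l).
rewrite IH orbT mulSn => /(leq_trans _)->//.
by rewrite addnC ltn_add2r.
Qed.

Lemma word_value_cat Y m k l :
  word_value Y m (k + l) = (word_value Y m k * b ^ l + word_value Y (m + k) l)%N.
Proof.
elim: l => [|l IH] /=; first by rewrite addn0 muln1 addn0.
by rewrite addnS /= IH expnSr mulnDl mulnA !addnA.
Qed.

Lemma word_value_eq (Y f : nat -> 'I_b) m l :
  (word_value Y m l == word_value f 0 l) =
  all (fun o => Y (m + o)%N == f o) (iota 0 l).
Proof.
elim: l => // l IH.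
have -> : iota 0 l.+1 = iota 0 l ++ [:: l] by rewrite -addn1 iotaD.
rewrite all_cat -IH /= andbT add0n -val_eqE /=.
apply/eqP/andP => [h|[/eqP-> /eqP->]//].
have b0 : (0 < b)%N by lia.
have hd := congr1 (divn^~ b) h; have hm := congr1 (modn^~ b) h.
rewrite !divnMDl // !divn_small // !addn0 in hd.
by rewrite !modnMDl !modn_small // in hm; rewrite hd hm.
Qed.

Lemma eq_word_value (Y Z : nat -> 'I_b) m l :
  (forall o, (o < l)%N -> Y (m + o)%N = Z (m + o)%N) ->
  word_value Y m l = word_value Z m l.
Proof.
elim: l => //= l IH h; rewrite h // IH // => o ol; apply: h; exact: ltnW.
Qed.

Lemma word_value_surj l d : (d < b ^ l)%N -> exists f, word_value f 0 l = d.
Proof.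
have b0 : (0 < b)%N by lia.
elim: l d => [|l IH] d.
  by rewrite expn0 ltnS leqn0 => /eqP->; exists (fun=> Ordinal b0).
rewrite expnSr => hd.
have [f fd] : exists f, word_value f 0 l = (d %/ b)%N by apply: IH; rewrite ltn_divLR.
exists (fun o => if (o < l)%N then f o else Ordinal (ltn_pmod d b0)) => /=.
rewrite add0n ltnn /= [RHS](divn_eq d b) -fd; congr (_ * _ + _)%N.
by apply: eq_word_value => o ol; rewrite add0n ol.
Qed.

Variable R : realType.

Lemma floor_expansionS (Y : nat -> 'I_b) (r : R) n : is_expansion Y r ->
  Num.floor (b%:R ^+ n.+1 * r) = Num.floor (b%:R ^+ n * r) * b%:Z + (Y n : nat)%:Z.
Proof.
move=> [_ /(_ n.+1 isT)]; rewrite /letter /= => <-; rewrite /digit.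
set F := Num.floor (_ ^+ n.+1 * _).
have bz : (0 < b%:Z) by lia.
have bR : 0 < b%:R :> R by rewrite ltr0n; lia.
(* The remainder of [F] modulo [b] is the digit; what is left is that the quotient is the floor of
   b^n r. *)
rewrite {1}(divz_eq F b); congr (_ * _ + _); apply/esym/floor_def.
have /andP[h1 h2] := floor_itv (b%:R ^+ n.+1 * r); rewrite -/F in h1 h2.
apply/andP; split.
  rewrite -(ler_pM2l bR) mulrA -exprS (le_trans _ h1) //.
  by rewrite -[b%:R]/(b%:Z%:~R) -intrM ler_int mulrC lez_floor // gt_eqF.
rewrite -(ltr_pM2l bR) mulrA -exprS (lt_le_trans h2) //.
rewrite -[b%:R]/(b%:Z%:~R) -intrM ler_int mulrC.
by have := ltz_ceil F bz; lia.
Qed.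

Lemma floor_expansionD (Y : nat -> 'I_b) (r : R) m l : is_expansion Y r ->
  Num.floor (b%:R ^+ (m + l) * r) =
  Num.floor (b%:R ^+ m * r) * (b ^ l)%:Z + (word_value Y m l)%:Z.
Proof.
move=> hr; elim: l => [|l IH]; first by rewrite addn0 /= mulr1 addr0.
rewrite addnS (floor_expansionS _ hr) IH /= expnSr !PoszD !PoszM; ring.
Qed.

(** A digit in base b^l groups l consecutive digits in base b; reduction modulo b^l erases the
    earlier ones. *)
Lemma digit_pow (Y : nat -> 'I_b) (r : R) l n : is_expansion Y r ->
  digit (b ^ l) r n.+1 = (word_value Y (l * n) l)%:Z.
Proof.
move=> hr; rewrite /digit natrX -exprM mulnS addnC (floor_expansionD _ _ hr).
by rewrite modzMDl modz_small //= ltz_nat ?word_value_lt.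
Qed.

(** Digits in base [b ^ l] correspond one to one to words of length [l], and successive digits read
    successive aligned blocks. *)
Lemma normal_number_uniform (Y : nat -> 'I_b) (r : R) : is_expansion Y r ->
  normal_number b r <->
  (forall l, (0 < l)%N -> uniform_on R (fun o n => Y (l * n + o)%N) (iota 0 l)).
Proof.
move=> hr.
have E l (f : nat -> 'I_b) :
    has_frequency [pred n | digit (b ^ l) r n == (word_value f 0 l)%:Z]
      ((b ^ l)%:R^-1 : R) <->
    mean_zero (fun n => (all (fun o => Y (l * n + o)%N == f o) (iota 0 l))%:R
                        - b%:R ^- size (iota 0 l) : R).
  have Q n : digit (b ^ l) r n.+1 == (word_value f 0 l)%:Z =
     all (fun o => Y (l * n + o)%N == f o) (iota 0 l).
    by rewrite (digit_pow _ _ hr) eqz_nat word_value_eq.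
  split=> [/has_frequencyP H|H].
    by apply: eq_mean_zero H => n; rewrite /= Q size_iota natrX.
  by apply/has_frequencyP; apply: eq_mean_zero H => n; rewrite /= Q size_iota natrX.
split=> [H l l0 f|H l l0 d hd].
  by apply/E; apply: H => //; exact: word_value_lt.
by have [f <-] := word_value_surj hd; apply/E; apply: H.
Qed.

(* An expansion ending in b-1, b-1, and so on is never produced by the
   floor-based digits. *)
Lemma exists_expansion (Y : nat -> 'I_b) :
  (forall n, exists2 m, (n <= m)%N & (Y m).+1 != b) ->
  exists r : R, is_expansion Y r.
Proof.
move=> inf.
have bR : 0 < b%:R :> R by rewrite ltr0n; lia.
have bX n : 0 < b%:R ^+ n :> R by exact: exprn_gt0.
pose V n : R := (word_value Y 0 n)%:R.
have VD n k : V (n + k)%N = V n * b%:R ^+ k + (word_value Y n k)%:R.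
  by rewrite /V word_value_cat add0n natrD natrM natrX.
have lower n k : V n / b%:R ^+ n <= V (n + k)%N / b%:R ^+ (n + k).
  rewrite VD exprD ler_pdivrMr // mulrAC ler_pdivlMr ?mulr_gt0 //.
  by rewrite [b%:R ^+ n * _]mulrC mulrA ler_wpM2r ?lerDl // ltW.
have upper n k : (V (n + k)%N + 1) / b%:R ^+ (n + k) <= (V n + 1) / b%:R ^+ n.
  rewrite VD exprD ler_pdivrMr ?mulr_gt0 // mulrAC ler_pdivlMr //.
  rewrite [b%:R ^+ n * _]mulrC mulrA ler_wpM2r ?(ltW (bX _)) //.
  rewrite mulrDl mul1r -addrA lerD2l.
  by rewrite -natrX natr1 ler_nat word_value_lt.
have VU n : V n / b%:R ^+ n <= (V n + 1) / b%:R ^+ n.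
  by rewrite ler_wpM2r ?invr_ge0 ?(ltW (bX _)) // lerDl.
have LU n k : V n / b%:R ^+ n <= (V k + 1) / b%:R ^+ k.
  have [nk|/ltnW kn] := leqP n k.
    by have := lower n (k - n)%N; rewrite subnKC // => /le_trans; apply.
  by have := upper k (n - k)%N; rewrite subnKC //; apply: le_trans.
pose S := [set V n / b%:R ^+ n | n in setT]%classic.
have hasS : has_sup S.
  split; first by exists (V 0%N / b%:R ^+ 0); exists 0%N.
  by exists ((V 0%N + 1) / b%:R ^+ 0) => _ [n _ <-]; exact: LU.
(* The truncations V n / b^n increase, and each (V n + 1) / b^n bounds all of them. *)
pose r := sup S; exists r.
have rl n : V n / b%:R ^+ n <= r.
  by apply: (sup_upper_bound hasS); exists n.
have ru n : r <= (V n + 1) / b%:R ^+ n.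
  by apply: ge_sup => [|_ [k _ <-]]; [exact: (proj1 hasS) | exact: LU].
(* At a letter other than b - 1 beyond n the upper bound strictly decreases; this strictness makes
   the floors exact. *)
have rlt n : r < (V n + 1) / b%:R ^+ n.
  have [m nm Ym] := inf n.
  apply: (le_lt_trans (ru m.+1)).
  have := upper n (m - n)%N; rewrite subnKC //; apply: lt_le_trans.
  rewrite exprS invfM mulrA ltr_pM2r ?invr_gt0 // ltr_pdivrMr //.
  rewrite /V /= natr1 natr1 -natrM ltr_nat add0n.
  by have := ltn_ord (Y m); move: Ym; rewrite mulSn; lia.
have fl n : Num.floor (b%:R ^+ n * r) = (word_value Y 0 n)%:Z.
  apply: floor_def; apply/andP; split.
    by have := rl n; rewrite ler_pdivrMr // mulrC.
  by have := rlt n; rewrite ltr_pdivlMr // mulrC intrD.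
split.
  by have := rl 0%N; have := rlt 0%N; rewrite /V /= expr0 !divr1 add0r => -> ->.
case=> // n _; rewrite /digit fl /letter /= modz_nat; congr Posz.
by rewrite add0n modnMDl modn_small.
Qed.

(** If every letter were b - 1 from some point on, the digit 0 would have frequency 0 instead of
    1/b. *)
Lemma uniform_not_eventually_max (Y : nat -> 'I_b) :
  uniform_on R (fun o n => Y (1 * n + o)%N) (iota 0 1) ->
  forall n, exists2 m, (n <= m)%N & (Y m).+1 != b.
Proof.
move=> H n; apply: contrapT => no.
have b0 : (0 < b)%N by lia.
have Ymax m : (n <= m)%N -> (Y m).+1 = b.
  by move=> nm; apply/eqP; apply: contrapT => /negP ?; apply: no; exists m.
pose u k : R := (Y k == Ordinal b0)%:R - b%:R^-1.
have u1 k : `|u k| <= 1 by have := indicator_sub_le1 R b2 (Y k == Ordinal b0) 1.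
have mu : mean_zero u.
  by apply: eq_mean_zero (H (fun=> Ordinal b0)) => k; rewrite /= mul1n addn0 andbT.
have H1 := (mean_zero_shift n u1).2 mu.
have bR : 0 < b%:R^-1 :> R by rewrite invr_gt0 ltr0n.
have [|N0 /(_ N0.+1 (leqnSn _))] := H1 (b%:R^-1 / 2); first lra.
rewrite (eq_bigr (fun=> - b%:R^-1)) => [|k _]; last first.
  rewrite /u -val_eqE /=.
  have := Ymax (n + k)%N (leq_addr _ _).
  by case: (nat_of_ord (Y _)) => [|y] /= ; [lia | rewrite sub0r].
rewrite sumr_const card_ord normrMn normrN gtr0_norm // -mulr_natr.
have : 0 < N0.+1%:R :> R by [].
nra.
Qed.

End Digits.

(** * Condition (II) as joint equidistribution of letters *)

Lemma occurs_all (T : eqType) (a0 : T) (x : nat -> T) u m :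
  occurs x u m = all (fun c => letter x (m + c) == nth a0 u c) (iota 0 (size u)).
Proof.
rewrite /occurs -{2}(mkseq_nth a0 u) /mkseq.
apply/eqP/allP => [/eq_in_map h c /h/eqP//|h].
by apply/eq_in_map => c /h/eqP.
Qed.

Section Positions.
Variables (R : realType) (b : nat) (p1 p2 k : nat) (x : nat -> 'I_b).

Local Notation pos := ('I_k.+1 * 'I_k.+1 * nat)%type.

(* Sums start at n = 0, hence n.+1 for the n of condition (II). *)
Definition scaled_letter (j : pos) (n : nat) : 'I_b :=
  letter x ((p1 - 1) * (p2 - 1) * p1 ^ j.1.1 * p2 ^ j.1.2 * n.+1 + j.2)%N.

(** The triple (i1, i2, c) points at letter c, counted from 0, of the word with indices i1, i2. *)
Definition positions (len : 'I_k.+1 -> 'I_k.+1 -> nat) : seq pos :=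
  [seq (i, c) | i <- enum {: 'I_k.+1 * 'I_k.+1}, c <- iota 0 (len i.1 i.2)].

Lemma mem_positions len i1 i2 c : ((i1, i2, c) \in positions len) = (c < len i1 i2)%N.
Proof.
apply/allpairsPdep/idP => [[i [c' [_ hc [e ->]]]]|h].
  by move: hc; rewrite -e mem_iota.
by exists (i1, i2), c; rewrite mem_enum mem_iota.
Qed.

Lemma uniq_positions len : uniq (positions len).
Proof.
apply: allpairs_uniq_dep => [|i _|]; [exact: enum_uniq | exact: iota_uniq |].
by move=> [i c] [i' c'] _ _ /= [-> ->].
Qed.

Lemma size_positions len :
  size (positions len) = (\sum_(i1 < k.+1) \sum_(i2 < k.+1) len i1 i2)%N.
Proof.
rewrite size_allpairs_dep sumnE big_map big_enum /= pair_big /=.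
by apply: eq_bigr => i _; rewrite size_iota.
Qed.

(** Simultaneous occurrence of the words prescribes one letter per position, and the positions
    number the sum of the lengths. [a0] is only the default of [nth], never reached on
    [positions len]. *)
Lemma frequency_positions (a0 : 'I_b) (u : 'I_k.+1 -> 'I_k.+1 -> seq 'I_b) :
  let len i1 i2 := size (u i1 i2) in
  has_frequency
    [pred n : nat | [forall i1 : 'I_k.+1, forall i2 : 'I_k.+1,
       occurs x (u i1 i2)
         ((p1 - 1) * (p2 - 1) * p1 ^ i1 * p2 ^ i2 * n)%N]]
    (b%:R ^- (\sum_(i1 < k.+1) \sum_(i2 < k.+1) size (u i1 i2))%N : R) <->
  mean_zero (fun n =>
    (all (fun j => scaled_letter j n == nth a0 (u j.1.1 j.1.2) j.2)
       (positions len))%:R - b%:R ^- size (positions len) : R).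
Proof.
move=> len.
have E n : [forall i1 : 'I_k.+1, forall i2 : 'I_k.+1,
       occurs x (u i1 i2)
         ((p1 - 1) * (p2 - 1) * p1 ^ i1 * p2 ^ i2 * n.+1)%N] =
   all (fun j => scaled_letter j n == nth a0 (u j.1.1 j.1.2) j.2) (positions len).
  apply/forallP/allP => [h [[i1 i2] c]|h i1].
    rewrite mem_positions => hc; move/forallP: (h i1) => /(_ i2).
    by rewrite (occurs_all a0) => /allP/(_ c); rewrite mem_iota; apply.
  apply/forallP => i2; rewrite (occurs_all a0); apply/allP => c.
  by rewrite mem_iota /= => hc; apply: (h (i1, i2, c)); rewrite mem_positions.
split=> [/has_frequencyP H|H].
  by apply: eq_mean_zero H => n; rewrite /= E size_positions.
by apply/has_frequencyP; apply: eq_mean_zero H => n; rewrite /= E size_positions.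
Qed.

End Positions.

(** * The two implications, through distinct offsets in the transform *)

Section Equivalence.
Variables (R : realType) (b : nat) (p1 p2 : nat) (x : nat -> 'I_b).
Hypotheses (b2 : (2 <= b)%N) (P1 : prime p1) (P2 : prime p2) (ne12 : p1 != p2).

Local Notation t := (toeplitz p1 p2 x).

Lemma toeplitz_pos K i1 i2 n m o : (i1 <= K)%N -> (i2 <= K)%N -> pfree p1 p2 m ->
  o.+1 = (m * p1 ^ (K - i1) * p2 ^ (K - i2))%N ->
  t ((p1 * p2) ^ K.+1 * n + o)%N =
  letter x ((p1 - 1) * (p2 - 1) * p1 ^ i1 * p2 ^ i2 * n + pfree_rank p1 p2 m)%N.
Proof.
move=> h1 h2 fm e; have := letter_toeplitz P1 P2 ne12 x n h1 h2 fm.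
by rewrite -e => <-; rewrite /letter addnS.
Qed.

(** Each scaled letter of [x] is a letter of [t] at a fixed offset from multiples of (p1 p2)^(k+1).
    Distinct triples give distinct offsets, so [uniform_on_progression] applies. *)
Lemma uniform_scaled_letter k (O : seq ('I_k.+1 * 'I_k.+1 * nat)) :
  (forall l, (0 < l)%N -> uniform_on R (fun o n => t (l * n + o)%N) (iota 0 l)) ->
  uniq O -> uniform_on R (scaled_letter p1 p2 x) O.
Proof.
move=> H uO.
(* [j] inverts the rank, so it enumerates the [pfree] integers; its value at 0 is arbitrary. *)
have /choice[j hj] : forall r, exists m,
    (0 < r)%N -> pfree p1 p2 m /\ pfree_rank p1 p2 m = r.
  case=> [|r]; first by exists 0%N.
  by have [m fm rm] := pfree_rank_surj P1 P2 ne12 (ltn0Sn r); exists m.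
(* [scaled_letter] uses [n.+1]; moving the surplus multiple into the rank leaves a multiple of [n]
   and makes the rank positive even for letter 0 of a word. *)
pose r (i : 'I_k.+1 * 'I_k.+1 * nat) :=
  ((p1 - 1) * (p2 - 1) * p1 ^ i.1.1 * p2 ^ i.1.2 + i.2)%N.
have r0 i : (0 < r i)%N.
  apply: ltn_addr; rewrite !muln_gt0 !subn_gt0 !expn_gt0.
  by rewrite (prime_gt1 P1) (prime_gt1 P2) (prime_gt0 P1) (prime_gt0 P2).
have fj i : pfree p1 p2 (j (r i)) by case: (hj _ (r0 i)).
have rj i : pfree_rank p1 p2 (j (r i)) = r i by case: (hj _ (r0 i)).
pose s i := (j (r i) * p1 ^ (k - i.1.1) * p2 ^ (k - i.1.2))%N.
have s0 i : (0 < s i)%N.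
  by rewrite !muln_gt0 (pfree_gt0 (fj i)) !expn_gt0 !prime_gt0.
(* The valuations at p1 and p2 recover the exponents, and the rank of the remaining factor recovers
   the letter index. *)
have sinj : injective s.
  move=> i i' e.
  have [l1 l2] := logn_pfree P1 P2 ne12 (k - i.1.1) (k - i.1.2) (fj i).
  have [l1' l2'] := logn_pfree P1 P2 ne12 (k - i'.1.1) (k - i'.1.2) (fj i').
  have := pfree_partE (k - i.1.1) (k - i.1.2) P1 P2 ne12 (fj i).
  have := pfree_partE (k - i'.1.1) (k - i'.1.2) P1 P2 ne12 (fj i').
  rewrite -/(s i) -/(s i') -e in l1 l2 l1' l2' * => -> /(congr1 (pfree_rank p1 p2)).
  rewrite !rj /r.
  have e1 : i'.1.1 = i.1.1.
    by apply: val_inj => /=; have := ltn_ord i.1.1; have := ltn_ord i'.1.1; lia.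
  have e2 : i'.1.2 = i.1.2.
    by apply: val_inj => /=; have := ltn_ord i.1.2; have := ltn_ord i'.1.2; lia.
  rewrite e1 e2 => /addnI; move: e1 e2.
  by case: i i' {e l1 l2 l1' l2'} => [[? ?] ?] [[? ?] ?] /= -> -> ->.
pose h i := (s i).-1.
have hinj : injective h.
  move=> i i' /(congr1 succn); rewrite /h !prednK //; exact: sinj.
have D0 : (0 < (p1 * p2) ^ k.+1)%N by rewrite expn_gt0 muln_gt0 !prime_gt0.
apply: (uniform_on_embed (h := h) b2 _ uO _ _ _
   (uniform_on_progression b2 D0 (undup_uniq (map h O)) H)).
- exact: undup_uniq.
- by move=> i i' _ _; exact: hinj.
- by move=> i iO; rewrite mem_undup map_f.
move=> i _ n; have [k1 k2] : (i.1.1 <= k)%N /\ (i.1.2 <= k)%N by split; rewrite -ltnS.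
rewrite (toeplitz_pos n k1 k2 (fj i) (prednK (s0 i))) rj /scaled_letter /r.
by rewrite mulnS -addnA addnCA.
Qed.

(** An offset allowed in [uniform_on_aligned] has both valuations of [o.+1] at most [K]; subtracting
    them from [K] gives exponents for which the letter of [t] is a scaled letter of [x]. *)
Lemma uniform_toeplitz :
  (forall k (O : seq ('I_k.+1 * 'I_k.+1 * nat)), uniq O ->
     uniform_on R (scaled_letter p1 p2 x) O) ->
  forall l, (0 < l)%N -> uniform_on R (fun o n => t (l * n + o)%N) (iota 0 l).
Proof.
move=> H; apply: (uniform_on_aligned b2 (prime_gt1 P1) (prime_gt1 P2)) => K O uO adm.
have lK o : o \in O -> (logn p1 o.+1 <= K)%N && (logn p2 o.+1 <= K)%N.
  by move=> /adm; rewrite !pfactor_dvdn // -!leqNgt.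
pose h o : 'I_K.+1 * 'I_K.+1 * nat :=
  (inord (K - logn p1 o.+1), inord (K - logn p2 o.+1),
   pfree_rank p1 p2 (pfree_part p1 p2 o.+1)).
have hinj : {in O &, injective h}.
  move=> o o' /lK /andP[h1 h2] /lK /andP[h1' h2'] [].
  move=> /(congr1 val) /=; rewrite !inordK ?ltnS ?leq_subr // => e1.
  move=> /(congr1 val) /=; rewrite !inordK ?ltnS ?leq_subr // => e2.
  move=> /(pfree_rank_inj (pfree_pfree_part P1 P2 ne12 (ltn0Sn o))
     (pfree_pfree_part P1 P2 ne12 (ltn0Sn o'))) e3.
  apply: succn_inj; rewrite -(pfree_partK P1 P2 ne12 o.+1).
  rewrite -(pfree_partK P1 P2 ne12 o'.+1) e3.
  have -> : logn p1 o.+1 = logn p1 o'.+1 by lia.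
  by have -> : logn p2 o.+1 = logn p2 o'.+1 by lia.
apply: (uniform_on_embed (h := h) b2 _ uO hinj _ _ (H K _ (undup_uniq (map h O)))).
- exact: undup_uniq.
- by move=> o oO; rewrite mem_undup map_f.
move=> o /lK /andP[h1 h2] n.
rewrite (@toeplitz_pos K (K - logn p1 o.+1) (K - logn p2 o.+1) _
  (pfree_part p1 p2 o.+1)) ?leq_subr //.
- by rewrite /scaled_letter /= !inordK ?ltnS ?leq_subr.
- exact: pfree_pfree_part.
- by rewrite !subKn // pfree_partK.
Qed.

End Equivalence.

Theorem theorem4 (R : realType) (b : nat) (hb : (2 <= b)%N)
    (p1 p2 : nat) (hp1 : prime p1) (hp2 : prime p2) (hp12 : p1 != p2)
    (x : nat -> 'I_b) :
  normal_seq R (toeplitz p1 p2 x) <->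
  (forall (k : nat) (u : 'I_k.+1 -> 'I_k.+1 -> seq 'I_b),
     has_frequency
       [pred n : nat | [forall i1 : 'I_k.+1, forall i2 : 'I_k.+1,
          occurs x (u i1 i2)
            ((p1 - 1) * (p2 - 1) * p1 ^ i1 * p2 ^ i2 * n)%N]]
       (b%:R ^- (\sum_(i1 < k.+1) \sum_(i2 < k.+1) size (u i1 i2))%N : R)).
Proof.
split=> [[r [xr nr]] k u|H].
  have al := (normal_number_uniform hb xr).1 nr.
  apply/(frequency_positions _ _ _ _ (x 0%N)).
  exact: (uniform_scaled_letter hb hp1 hp2 hp12 al (uniq_positions _)
            (fun j => nth (x 0%N) (u j.1.1 j.1.2) j.2)).
have al : forall l, (0 < l)%N ->
    uniform_on R (fun o n => toeplitz p1 p2 x (l * n + o)%N) (iota 0 l).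
  apply: uniform_toeplitz => // k O uO.
  (* Words of the common length [C] at all pairs of exponents cover every position in [O]; the rest
     is removed by [uniform_on_sub]. *)
  pose C := (\max_(j <- O) j.2.+1)%N.
  have OC j : j \in O -> (j.2 < C)%N.
    by move=> jO; rewrite /C (big_rem j) //= leq_max leqnn.
  pose len (_ _ : 'I_k.+1) := C.
  apply: (uniform_on_sub hb (uniq_positions len) uO) => [[[i1 i2] c] /OC|f].
    by rewrite mem_positions.
  pose u i1 i2 := mkseq (fun c => f (i1, i2, c)) C.
  have := (frequency_positions R p1 p2 x (x 0%N) u).1 (H k u).
  have -> : (fun i1 i2 => size (u i1 i2)) = len.
    by apply/funext => i1; apply/funext => i2; rewrite size_mkseq.
  apply: eq_mean_zero => n; congr ((nat_of_bool _)%:R - _).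
  apply: eq_in_all => -[[i1 i2] c]; rewrite mem_positions => hc /=.
  by rewrite nth_mkseq.
(* Equidistribution of single letters excludes a tail of letters b - 1, so the transform is a
   genuine expansion. *)
have [r xr] := exists_expansion hb R (uniform_not_eventually_max hb (al 1%N isT)).
by exists r; split=> //; exact: (normal_number_uniform hb xr).2 al.
Qed.
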